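(* There exist an integral domain $D$ and an ab star operation $\ast$ on $D$ which is not a (star) $\mathcal W$-operation.
   Context: Let $D$ be an integral domain with quotient field $K$. $\boldsymbol F(D)$ is the set of all nonzero fractional ideals of $D$, and $\boldsymbol f(D)$ is the set of all nonzero finitely generated fractional ideals of $D$. A star operation of $D$ is a map $\ast:\boldsymbol F(D)\to\boldsymbol F(D)$, $E\mapsto E^\ast$, such that for all $0\ne z\in K$ and all $E,F\in\boldsymbol F(D)$: $(zD)^\ast=zD$ and $(zE)^\ast=zE^\ast$; $E\subseteq F$ implies $E^\ast\subseteq F^\ast$; $E\subseteq E^\ast$ and $(E^\ast)^\ast=E^\ast$. $\ast$ is ab if, for all $F\in\boldsymbol f(D)$ and all $G,H\in\boldsymbol F(D)$, $(FG)^\ast\subseteq(FH)^\ast$ implies $G^\ast\subseteq H^\ast$. A (star) $\mathcal W$-operation is a star operation of the form $E\mapsto\bigcap\{EW: W\in\mathcal W\}$ for $E\in\boldsymbol F(D)$, where $\mathcal W$ is a family of valuation overrings of $D$ (valuation domains between $D$ and $K$) with $D=\bigcap\{W: W\in\mathcal W\}$. *)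

(* Defs.v *)
From HB Require Import structures.
From mathcomp Require Import all_boot all_order all_algebra.
From mathcomp Require Import boolp classical_sets cardinality.
Set Implicit Arguments.
Unset Strict Implicit.
Unset Printing Implicit Defensive.
Import GRing.Theory.
Local Open Scope classical_set_scope.
Local Open Scope ring_scope.

(* The domain D is identified with the subring [range (@tofrac D)] of its
   quotient field {fraction D}. *)
Section Defs.
Variable D : idomainType.
Local Notation K := {fraction D}.
Local Notation "x %:F" := (@tofrac D x).
Implicit Types (E F G H V A B : set K) (star : set K -> set K).

Definition domainSub : set K := range (@tofrac D).

Record submodule E : Prop := Submodule {
  submodule0 : E 0;
  submoduleD : forall x y, E x -> E y -> E (x + y);
  submoduleZ : forall (d : D) x, E x -> E (d%:F * x) }.

Definition scaleSub (z : K) E : set K := [set z * x | x in E].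

Definition dspan A : set K := smallest submodule A.

(* For an overring V of D, [mulSub E V] is already closed under multiplication
   by V, so it is the extension EV as well. *)
Definition mulSub A B : set K := dspan [set a * b | a in A & b in B].

Record fracIdeal E : Prop := FracIdeal {
  fracIdeal_submodule : submodule E;
  fracIdeal_nonzero : exists2 x, E x & x != 0;
  fracIdeal_denominator : exists2 d : D, d != 0 & scaleSub d%:F E `<=` domainSub }.

Definition fgFracIdeal F : Prop :=
  fracIdeal F /\ exists2 A, finite_set A & F = dspan A.

(* A map on nonzero fractional ideals is represented by a map on all subsets
   of K; its values elsewhere are never constrained or used. *)
Record starOperation star : Prop := StarOperation {
  star_fracIdeal : forall E, fracIdeal E -> fracIdeal (star E);
  star_principal : forall z, z != 0 -> star (scaleSub z domainSub) = scaleSub z domainSub;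
  star_scale : forall z E, z != 0 -> fracIdeal E ->
    star (scaleSub z E) = scaleSub z (star E);
  star_mono : forall E F, fracIdeal E -> fracIdeal F ->
    E `<=` F -> star E `<=` star F;
  star_ext : forall E, fracIdeal E -> E `<=` star E;
  star_idem : forall E, fracIdeal E -> star (star E) = star E }.

Definition abStar star : Prop :=
  forall F G H, fgFracIdeal F -> fracIdeal G -> fracIdeal H ->
    star (mulSub F G) `<=` star (mulSub F H) -> star G `<=` star H.

(* The quotient field of any ring between D and K is K, whence the usual
   definition of a valuation domain by x \in V or x^-1 \in V. The field K itself
   is allowed. *)
Record valuationOverring V : Prop := ValuationOverring {
  overring_domain : domainSub `<=` V;
  overringB : forall x y, V x -> V y -> V (x - y);
  overringM : forall x y, V x -> V y -> V (x * y);
  overring_valuation : forall x, x != 0 -> V x \/ V x^-1 }.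

(* Intersections are taken inside K: that of the empty family is K. *)
Definition WOperation star : Prop :=
  starOperation star /\
  exists W : set (set K),
    [/\ forall V, W V -> valuationOverring V,
        domainSub = \bigcap_(V in W) V
      & forall E, fracIdeal E -> star E = \bigcap_(V in W) mulSub E V].

End Defs.

(* Main.v *)
Require Import Defs.
From HB Require Import structures.
From mathcomp Require Import all_boot all_order all_algebra all_field.
From mathcomp Require Import boolp classical_sets cardinality.
Set Implicit Arguments.
Unset Strict Implicit.
Unset Printing Implicit Defensive.
Import GRing.Theory Num.Theory.
Local Open Scope classical_set_scope.
Local Open Scope ring_scope.

(** On a valuation domain D every finitely generated fractional ideal is principal, so
    every star operation is ab; in particular the divisorial closure v is. If the maximal
    ideal M is the radical of a principal ideal, D is not an intersection of proper
    overrings, so a family of overrings defining a W-operation must contain D itself;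
    such an operation fixes M. But if every element of M is a square of an element of M
    then M^v = D. As D we take a subring of the algebraic numbers maximal among those not
    containing 1/2: maximality makes it a valuation ring in which M is the radical of (2),
    and square roots exist because the field is algebraically closed. *)

(** * Subrings of a field and adjunction of an element *)

Record subringSet (L : fieldType) (A : set L) : Prop := SubringSet {
  subringSet1 : A 1;
  subringSetB : forall x y, A x -> A y -> A (x - y);
  subringSetM : forall x y, A x -> A y -> A (x * y) }.

Section SubringSetTheory.
Variables (L : fieldType) (S : set L).
Hypothesis subS : subringSet S.

Lemma subringSet0 : S 0.
Proof. by rewrite -(subrr 1); apply: subringSetB => //; apply: subringSet1. Qed.

Lemma subringSetN x : S x -> S (- x).
Proof. by move=> Sx; rewrite -sub0r; apply: subringSetB => //; apply: subringSet0. Qed.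

Lemma subringSetD x y : S x -> S y -> S (x + y).
Proof.
by move=> Sx Sy; rewrite -[y]opprK; apply: subringSetB => //; apply: subringSetN.
Qed.

Lemma subringSetX x n : S x -> S (x ^+ n).
Proof.
move=> Sx; elim: n => [|n IHn]; first exact: subringSet1.
by rewrite exprS; apply: subringSetM.
Qed.

(** The degree bound stays explicit because it is the quantity lowered by the descent below, and the
    exponent used to clear denominators. *)
Definition adjoinLe (x : L) (n : nat) : set L :=
  [set y | exists2 a : nat -> L, (forall i, S (a i)) &
                                 y = \sum_(i < n.+1) a i * x ^+ i].

Definition adjoin (x : L) : set L := \bigcup_n adjoinLe x n.

Lemma adjoinLe0 x n : adjoinLe x n 0.
Proof.
exists (fun=> 0) => [_|]; first exact: subringSet0.
by rewrite big1 // => i _; rewrite mul0r.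
Qed.

Lemma adjoinLeD x n y z : adjoinLe x n y -> adjoinLe x n z -> adjoinLe x n (y + z).
Proof.
move=> [a Sa ->] [b Sb ->]; exists (fun i => a i + b i).
  by move=> i; apply: subringSetD.
by rewrite -big_split /=; apply: eq_bigr => i _; rewrite mulrDl.
Qed.

Lemma adjoinLeZ x n s y : S s -> adjoinLe x n y -> adjoinLe x n (s * y).
Proof.
move=> Ss [a Sa ->]; exists (fun i => s * a i).
  by move=> i; apply: subringSetM.
by rewrite big_distrr /=; apply: eq_bigr => i _; rewrite mulrA.
Qed.

Lemma adjoinLe_sum x n (I : Type) (r : seq I) (F : I -> L) :
  (forall i, adjoinLe x n (F i)) -> adjoinLe x n (\sum_(i <- r) F i).
Proof.
move=> AF; elim/big_ind: _ => //; first exact: adjoinLe0.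
exact: adjoinLeD.
Qed.

Lemma adjoinLeX x n i : (i <= n)%N -> adjoinLe x n (x ^+ i).
Proof.
move=> le_in; exists (fun j => if j == i then 1 else 0).
  by move=> j; case: eqP => _; [apply: subringSet1 | apply: subringSet0].
have lt_in : (i < n.+1)%N by [].
rewrite (bigD1 (Ordinal lt_in)) //= eqxx mul1r big1 ?addr0 // => j.
by rewrite -val_eqE /= => /negPf ->; rewrite mul0r.
Qed.

Lemma adjoinLe_mono x m n : (m <= n)%N -> adjoinLe x m `<=` adjoinLe x n.
Proof.
move=> le_mn _ [a Sa ->]; apply: adjoinLe_sum => i.
by apply: adjoinLeZ => //; apply: adjoinLeX; rewrite (leq_trans _ le_mn) // -ltnS.
Qed.

Lemma adjoinLeM x m n y z :
  adjoinLe x m y -> adjoinLe x n z -> adjoinLe x (m + n) (y * z).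
Proof.
move=> [a Sa ->] [b Sb ->]; rewrite big_distrlr /=.
apply: adjoinLe_sum => i; apply: adjoinLe_sum => j.
rewrite mulrACA -exprD; apply: adjoinLeZ; first exact: subringSetM.
by apply: adjoinLeX; rewrite leq_add // -ltnS.
Qed.

Lemma sub_adjoin x : S `<=` adjoin x.
Proof.
move=> s Ss; exists 0 => //; rewrite -[s]mulr1 -(expr0 x).
by apply: adjoinLeZ => //; apply: adjoinLeX.
Qed.

Lemma mem_adjoin x : adjoin x x.
Proof. by exists 1 => //; have := @adjoinLeX x 1 1 isT. Qed.

Lemma adjoin_subringSet x : subringSet (adjoin x).
Proof.
split; first by apply: sub_adjoin; apply: subringSet1.
- move=> y z [m _ Hy] [n _ Hz]; exists (maxn m n) => //.
  apply: adjoinLeD; first exact: adjoinLe_mono (leq_maxl _ _) _ Hy.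
  rewrite -mulN1r; apply: adjoinLeZ; first by apply: subringSetN; apply: subringSet1.
  exact: adjoinLe_mono (leq_maxr _ _) _ Hz.
- by move=> y z [m _ Hy] [n _ Hz]; exists (m + n)%N => //; apply: adjoinLeM.
Qed.

(** A term in [x^-1 ^+ i] with [i <= n] turns into one in [x ^+ (n - i)]. This brings relations over
    [S[x^-1]] back into [S]. *)
Lemma adjoinLe_clear_denominator x n y :
  x != 0 -> S x -> adjoinLe x^-1 n y -> S (y * x ^+ n).
Proof.
move=> x0 Sx [a Sa ->]; rewrite big_distrl /=.
elim/big_ind: _ => [||i _]; [exact: subringSet0 | exact: subringSetD |].
have le_in : (i <= n)%N by rewrite -ltnS.
rewrite exprVn -mulrA; apply: subringSetM => //.
by rewrite mulrC -expfB_cond ?(negPf x0) ?add0n //; apply: subringSetX.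
Qed.

End SubringSetTheory.

(** * Subrings maximal among those avoiding an element *)

Definition maximalAvoiding (L : fieldType) (u : L) (S : set L) :=
  [/\ subringSet S, ~ S u &
      forall B, subringSet B -> S `<=` B -> ~ B u -> B `<=` S].

Section MaximalAvoiding.
Variables (L : fieldType) (u : L) (S : set L).
Hypothesis maxS : maximalAvoiding u S.
Hypothesis Suinv : S u^-1.

Let subS : subringSet S. Proof. by case: maxS. Qed.
Let Su : ~ S u. Proof. by case: maxS. Qed.
Let u0 : u != 0.
Proof. by apply/eqP => u_eq0; apply: Su; rewrite u_eq0; apply: subringSet0. Qed.

(** Otherwise [S[x]] avoids [u], so maximality gives [S[x] = S], which contains [x]. *)
Lemma maximalAvoiding_adjoin x : ~ S x -> adjoin S x u.
Proof.
move=> Sx; apply: contrapT => Au; apply: Sx.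
have [_ _ max] := maxS.
by apply: (max _ (adjoin_subringSet subS x)) => //; [apply: sub_adjoin | apply: mem_adjoin].
Qed.

(** Thus [u^-1] lies in the Jacobson radical of [S]. If [w = 1 - u^-1 * s] were not invertible in
    [S], then [u] would be in [S[w^-1]], so [u * w ^+ n] in [S]; but [w ^+ n] is 1 modulo [u^-1 S],
    which puts [u] in [S]. *)
Lemma maximalAvoiding_unit s : S s -> S (1 - u^-1 * s)^-1.
Proof.
move=> Ss; set w := 1 - _.
have Sus : S (u^-1 * s) by apply: subringSetM.
have Sw : S w by apply: subringSetB => //; apply: subringSet1.
have w0 : w != 0.
  apply/eqP => /subr0_eq us; apply: Su.
  by rewrite -[u]mulr1 us mulVKf.
apply: contrapT => /maximalAvoiding_adjoin [n _ /(adjoinLe_clear_denominator subS w0 Sw)].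
have [c Sc ->] : exists2 c, S c & w ^+ n = 1 - u^-1 * c.
  elim: n => [|n [c Sc IHn]].
    by exists 0; [apply: subringSet0 | rewrite mulr0 subr0].
  exists (s + w * c); first by apply: subringSetD => //; apply: subringSetM.
  by rewrite exprS IHn mulrBr mulr1 {1}/w mulrDr opprD addrA mulrCA.
rewrite mulrBr mulr1 mulVKf // => Suc; apply: Su.
by rewrite -(subrK c u); apply: subringSetD.
Qed.

(* Chevalley's descent: two relations of degrees m and n <= m expressing u through
   powers of x and of x^-1 lower the degree m. *)
Lemma adjoinLe_inv_disjoint x m n :
  x != 0 -> adjoinLe S x m u -> adjoinLe S x^-1 n u -> False.
Proof.
have [N] := ubnP (m + n)%N; elim: N => // N IHN in x m n *.
(* Exchanging [x] and [x^-1] exchanges the two degrees. *)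
wlog le_nm : x m n / (n <= m)%N => [WL|].
  have [le_nm|lt_mn] := leqP n m; first exact: WL.
  move=> ltN x0 Ax AV; apply: (WL x^-1 n m) => //; first exact: ltnW.
  - by rewrite addnC.
  - by rewrite invr_eq0.
  - by rewrite invrK.
move=> ltN x0 Ax [b Sb]; case: n => [|n] in le_nm ltN *.
  (* A relation of degree 0 says that [u] itself is in [S]. *)
  by rewrite big_ord1 mulr1 => ub; apply: Su; rewrite ub.
case: m => [|m] // in Ax le_nm ltN *.
move=> ub; have AV : adjoinLe S x^-1 n.+1 u by exists b.
apply: (IHN x m n.+1) AV => //.
move: ub; rewrite big_ord_recl expr0 mulr1 => ub.
(* Dividing the relation in [x^-1] by [u] and moving its constant term to the left leaves the unit
   [w] there and only negative powers of [x] on the right. *)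
set w := 1 - u^-1 * b 0.
have Sw : S w^-1 by apply: maximalAvoiding_unit.
have w0 : w != 0.
  apply/eqP => /subr0_eq us; apply: Su.
  by rewrite -[u]mulr1 us mulVKf.
have wE : w = u^-1 * \sum_(i < n.+1) b (lift ord0 i) * x^-1 ^+ lift ord0 i.
  by apply: (mulfI u0); rewrite mulVKf // mulrBr mulr1 mulVKf // {1}ub addrC addKr.
(* Multiplying by [w^-1 * x ^+ m.+1] gives exponents [m.+1 - i] with [1 <= i <= n.+1 <= m.+1], all
   between 0 and [m]. This eliminates the leading power from the relation in [x]. *)
have Axm : adjoinLe S x m (x ^+ m.+1).
  rewrite -[x ^+ _](mulVKf w0) mulrCA; apply: adjoinLeZ => //.
  rewrite wE -mulrA; apply: adjoinLeZ => //.
  rewrite big_distrl /=; apply: adjoinLe_sum => // i.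
  rewrite -mulrA; apply: adjoinLeZ => //.
  have le_im : (bump 0 i <= m.+1)%N by rewrite (leq_trans _ le_nm).
  rewrite exprVn mulrC -expfB_cond ?(negPf x0) ?add0n //.
  by apply: adjoinLeX => //; rewrite /bump /= add1n subSS leq_subr.
have [a Sa ->] := Ax; rewrite big_ord_recr /=.
apply: adjoinLeD => //; first by exists a.
exact: adjoinLeZ.
Qed.

Lemma maximalAvoiding_valuation x : x != 0 -> S x \/ S x^-1.
Proof.
move=> x0; apply: contrapT => /not_orP[Sx SVx].
have [m _ Am] := maximalAvoiding_adjoin Sx.
have [n _ An] := maximalAvoiding_adjoin SVx.
exact: adjoinLe_inv_disjoint Am An.
Qed.

(** That is, [x ^+ n] lies in [u^-1 S], so the maximal ideal is the radical of a principal ideal.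
    Maximality puts [u] in [S[x^-1]], and the denominator is then cleared. *)
Lemma maximalAvoiding_rad x :
  x != 0 -> S x -> ~ S x^-1 -> exists n, S (u * x ^+ n).
Proof.
move=> x0 Sx /maximalAvoiding_adjoin [n _ An]; exists n.
exact: adjoinLe_clear_denominator An.
Qed.

End MaximalAvoiding.

Lemma exists_maximalAvoiding (L : fieldType) (u : L) (A : set L) :
  subringSet A -> ~ A u -> exists2 S, maximalAvoiding u S & A `<=` S.
Proof.
move=> subA Au.
pose P (B : set L) := B = set0 \/ [/\ subringSet B, ~ B u & A `<=` B].
have chainP (F : set (set L)) : F `<=` P -> total_on F subset -> P (\bigcup_(B in F) B).
  move=> FP totF.
  have [[B0 FB0 B0n]|F0] := pselect (exists2 B, F B & B != set0); last first.
    left; apply/seteqP; split=> // x [B FB Bx]; case: F0; exists B => //.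
    by apply/set0P; exists x.
  have FP' B x : F B -> B x -> [/\ subringSet B, ~ B u & A `<=` B].
    by move=> FB Bx; case: (FP _ FB) => // B_0; rewrite B_0 in Bx.
  have F2 x y : (\bigcup_(B in F) B) x -> (\bigcup_(B in F) B) y ->
      exists B, [/\ F B, subringSet B, B x & B y].
    move=> [B FB Bx] [C FC Cy].
    have [sB _ _] := FP' _ _ FB Bx; have [sC _ _] := FP' _ _ FC Cy.
    by have [BC|CB] := totF _ _ FB FC; [exists C | exists B]; split=> //;
      [apply: BC | apply: CB].
  have /set0P[x0 B0x0] := B0n.
  have [sB0 _ AB0] := FP' _ _ FB0 B0x0.
  right; split; last by move=> x Ax; exists B0 => //; apply: AB0.
    split; first by exists B0 => //; apply: subringSet1.
    - move=> x y Fx Fy; have [B [FB sB Bx By]] := F2 _ _ Fx Fy.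
      by exists B => //; apply: subringSetB.
    - move=> x y Fx Fy; have [B [FB sB Bx By]] := F2 _ _ Fx Fy.
      by exists B => //; apply: subringSetM.
  by move=> [B FB Bu]; have [_ /(_ Bu)] := FP' _ _ FB Bu.
have [S [PS maxS]] := Zorn_bigcup chainP.
have PA : P A by right; split.
(* The empty set is not maximal: [A] satisfies [P] and contains 1. *)
have [S0|[sS nSu AS]] := PS.
  case: (maxS A) => //; rewrite S0 properEneq; split=> //.
  by apply/eqP => A0; have := subringSet1 subA; rewrite -A0.
exists S => //; split=> // B sB SB Bu; apply: contrapT => nBS.
apply: (maxS B); first by split.
by right; split=> //; apply: subset_trans SB.
Qed.

(** * A subring of a field as an integral domain *)

Section SubringDomain.
Variables (L : fieldType) (S : set L).
Hypothesis subS : subringSet S.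

(** The proof of [subringSet S] is an argument so that the predicate determines its closure
    instance, and hence the ring structure of the subtype. *)
Definition subringPred of subringSet S : {pred L} := fun x => `[< S x >].
Local Notation P := (subringPred subS).

Lemma subringPred_closed : subring_closed P.
Proof.
split=> [|x y /asboolP Sx /asboolP Sy|x y /asboolP Sx /asboolP Sy]; apply/asboolP.
- exact: subringSet1.
- exact: subringSetB.
- exact: subringSetM.
Qed.

HB.instance Definition _ := GRing.isSubringClosed.Build L P subringPred_closed.

Record subringDomain := SubringDomain { subringDomain_val : L; _ : subringDomain_val \in P }.

HB.instance Definition _ := [isSub for subringDomain_val].
HB.instance Definition _ := [Choice of subringDomain by <:].
HB.instance Definition _ := [SubChoice_isSubComNzRing of subringDomain by <:].

Implicit Types x y : subringDomain.

Definition subringDomain_unit : {pred subringDomain} :=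
  fun x => (val x != 0) && ((val x)^-1 \in P).
(** [insubd] falls back to [x] when the inverse leaves [S], in keeping with the convention that a
    nonunit is its own inverse. *)
Definition subringDomain_inv x : subringDomain := insubd x (val x)^-1.

Fact subringDomain_mulVx :
  {in subringDomain_unit, left_inverse 1 subringDomain_inv *%R}.
Proof.
by move=> x /andP[x0 PVx]; apply: val_inj; rewrite rmorphM rmorph1 /= insubdK // mulVf.
Qed.

Fact subringDomain_unitPl x y : y * x = 1 -> subringDomain_unit x.
Proof.
move=> /(congr1 val); rewrite rmorphM rmorph1 /= => yx.
have x0 : val x != 0 by apply: contra_eq_neq yx => ->; rewrite mulr0 eq_sym oner_eq0.
by rewrite /subringDomain_unit x0 -[_^-1]mul1r -yx mulfK // (valP y).
Qed.

Fact subringDomain_inv_out : {in [predC subringDomain_unit], subringDomain_inv =1 id}.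
Proof.
move=> x; rewrite inE /= /subringDomain_unit negb_and negbK => /orP[/eqP x0|nPVx].
  apply: val_inj; rewrite /subringDomain_inv x0 invr0 insubdK ?x0 //.
  by rewrite -x0; apply: valP.
by rewrite /subringDomain_inv /insubd insubN.
Qed.

HB.instance Definition _ := GRing.ComNzRing_hasMulInverse.Build subringDomain
  subringDomain_mulVx subringDomain_unitPl subringDomain_inv_out.
HB.instance Definition _ := [SubComUnitRing_isSubIntegralDomain of subringDomain by <:].

Definition mkSubringDomain s (Ss : S s) : subringDomain := SubringDomain (asboolT Ss).

Lemma subringDomain_mem x : S (val x).
Proof. exact/asboolP/(valP x). Qed.

Lemma subringDomain_val_eq0 x : (val x == 0) = (x == 0).
Proof. by rewrite -(inj_eq val_inj) rmorph0. Qed.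

Lemma subringDomain_dvd x y : x != 0 -> S (val y / val x) -> exists z, y = z * x.
Proof.
move=> x0 Sxy; exists (mkSubringDomain Sxy); apply: val_inj.
by rewrite rmorphM /= mulfVK // subringDomain_val_eq0.
Qed.

(** [{fraction D}] and [L] are distinct types; the equation [y * x = 1] in [D] carries invertibility
    from one to the other. *)
Lemma domainSub_tofracV x : x != 0 -> @domainSub subringDomain (tofrac x)^-1 -> S (val x)^-1.
Proof.
move=> x0 [y _ yx].
have xF0 : tofrac x != 0 by rewrite tofrac_eq0.
have xy : y * x = 1.
  by apply/eqP; rewrite -tofrac_eq tofracM tofrac1 yx mulVf.
rewrite -[_^-1]mul1r -(rmorph1 (val : subringDomain -> L)) -xy rmorphM.
by rewrite mulfK ?subringDomain_val_eq0 //; apply: subringDomain_mem.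
Qed.
End SubringDomain.

(** * Fractional ideals and the divisorial closure *)

Section FractionField.
Variable D : idomainType.
Local Notation K := {fraction D}.
Local Notation "x %:F" := (@tofrac D x).
Local Notation O := (@domainSub D).
Implicit Types (E F G H A : set K) (x y z : K).

Lemma domainSub_subringSet : subringSet O.
Proof.
split; first by exists 1 => //; apply: tofrac1.
- by move=> _ _ [a _ <-] [b _ <-]; exists (a - b) => //; apply: tofracB.
- by move=> _ _ [a _ <-] [b _ <-]; exists (a * b) => //; apply: tofracM.
Qed.
Local Notation OR := domainSub_subringSet.

Lemma fracP x : exists a b : D, b != 0 /\ x = a%:F / b%:F.
Proof.
elim/quotW: x => r; exists \n_r, \d_r; split; first exact: denom_ratioP.
have d0 : (\d_r)%:F != 0 by rewrite tofrac_eq0 denom_ratioP.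
apply: (mulIf d0); rewrite mulfVK //.
unlock FracField.tofrac; rewrite -[LHS]FracField.pi_mul.
apply/eqmodP; rewrite /= FracField.equivfE /FracField.mulf /=.
by rewrite !numden_Ratio ?mulf_neq0 ?oner_neq0 ?denom_ratioP // !mulr1 mulrC.
Qed.

Lemma submoduleM E x y : submodule E -> O x -> E y -> E (x * y).
Proof. by move=> sE [d _ <-]; apply: submoduleZ. Qed.

Lemma dspan_submodule A : submodule (dspan A).
Proof.
split.
- by move=> E [sE _]; apply: (submodule0 sE).
- move=> x y Hx Hy E EA; have [sE _] := EA.
  by apply: (submoduleD sE); [apply: Hx | apply: Hy].
- by move=> d x Hx E EA; have [sE _] := EA; apply: (submoduleZ sE); apply: Hx.
Qed.

Lemma sub_dspan A : A `<=` dspan A.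
Proof. exact: sub_smallest. Qed.

Lemma dspan_min A E : submodule E -> A `<=` E -> dspan A `<=` E.
Proof. exact: smallest_sub. Qed.

Lemma scaleSub_submodule z E : submodule E -> submodule (scaleSub z E).
Proof.
move=> sE; split.
- by exists 0; [apply: submodule0 | rewrite mulr0].
- move=> _ _ [x Ex <-] [y Ey <-].
  by exists (x + y); [apply: submoduleD | rewrite mulrDr].
- by move=> d _ [x Ex <-]; exists (d%:F * x); [apply: submoduleZ | rewrite mulrCA].
Qed.

Lemma domainSub_submodule : submodule O.
Proof.
split.
- exact: subringSet0 OR.
- by move=> x y; apply: (subringSetD OR).
- by move=> d x; apply: (subringSetM OR); exists d.
Qed.

Lemma mem_scaleSub z E x : z != 0 -> scaleSub z E x <-> E (z^-1 * x).
Proof.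
move=> z0; split=> [[y Ey <-]|Ex]; first by rewrite mulKf.
by exists (z^-1 * x) => //; rewrite mulVKf.
Qed.

Lemma scaleSubM y z E : scaleSub (y * z) E = scaleSub y (scaleSub z E).
Proof.
apply/seteqP; split=> [_ [x Ex <-]|_ [_ [x Ex <-] <-]].
  by exists (z * x); [exists x | rewrite mulrA].
by exists x; rewrite ?mulrA.
Qed.

Lemma scaleSub1 E : scaleSub 1 E = E.
Proof.
apply/seteqP; split=> [_ [x Ex <-]|x Ex]; first by rewrite mul1r.
by exists x; rewrite ?mul1r.
Qed.

Lemma scaleSubS z E F : E `<=` F -> scaleSub z E `<=` scaleSub z F.
Proof. by move=> EF _ [x Ex <-]; exists x => //; apply: EF. Qed.

(** The v-operation, as the intersection of the principal fractional ideals containing [E]; [z = 0]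
    occurs only if [E] has no nonzero element. *)
Definition divisorialClosure E : set K :=
  \bigcap_(z in [set z | E `<=` scaleSub z O]) scaleSub z O.
Local Notation "E ^v" := (divisorialClosure E) (at level 2, format "E ^v").

Lemma sub_divisorialClosure E : E `<=` E^v.
Proof. by move=> x Ex z; apply. Qed.

Lemma divisorialClosureS E F : E `<=` F -> E^v `<=` F^v.
Proof. by move=> EF x Ex z Fz; apply: Ex; apply: subset_trans Fz. Qed.

Lemma divisorialClosure_min E z : E `<=` scaleSub z O -> E^v `<=` scaleSub z O.
Proof. by move=> Ez x; apply. Qed.

Lemma divisorialClosure_idem E : E^v^v = E^v.
Proof.
apply/seteqP; split; last exact: sub_divisorialClosure.
by move=> x Ex z Ez; apply: Ex; apply: divisorialClosure_min.
Qed.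

(** One inclusion, proved for every nonzero scalar, suffices: applied to [z^-1] and [scaleSub z E]
    it yields the other. *)
Lemma divisorialClosure_scale z E : z != 0 -> (scaleSub z E)^v = scaleSub z E^v.
Proof.
move=> z0.
have sub y F : y != 0 -> scaleSub y F^v `<=` (scaleSub y F)^v.
  move=> y0 _ [x Fx <-] w Fw; rewrite -[w](mulVKf y0) scaleSubM.
  exists x => //; apply: Fx => /=; rewrite -[F]scaleSub1 -(mulVf y0) !scaleSubM.
  exact: scaleSubS.
apply/seteqP; split; last exact: sub.
rewrite -[X in X `<=` _]scaleSub1 -(mulfV z0) scaleSubM; apply: scaleSubS.
rewrite -[X in _ `<=` X^v]scaleSub1 -(mulVf z0) scaleSubM.
by apply: sub; rewrite invr_eq0.
Qed.

Lemma divisorialClosure_submodule E : submodule E^v.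
Proof.
have sz z := scaleSub_submodule z domainSub_submodule.
split.
- by move=> z _; apply: submodule0.
- by move=> x y Ex Ey z Ez; apply: submoduleD => //; [apply: Ex | apply: Ey].
- by move=> d x Ex z Ez; apply: submoduleZ => //; apply: Ex.
Qed.

Lemma divisorialClosure_star : starOperation divisorialClosure.
Proof.
split.
- move=> E fE; split; first exact: divisorialClosure_submodule.
    by have [x Ex x0] := fracIdeal_nonzero fE; exists x => //; apply: sub_divisorialClosure.
  have [d d0 dE] := fracIdeal_denominator fE; exists d => //.
  have dF0 : d%:F != 0 by rewrite tofrac_eq0.
  rewrite -divisorialClosure_scale // -[O]scaleSub1.
  by apply: divisorialClosure_min; rewrite scaleSub1.
- move=> z z0; apply/seteqP; split; last exact: sub_divisorialClosure.
  exact: divisorialClosure_min.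
- by move=> z E z0 _; apply: divisorialClosure_scale.
- by move=> E F _ _; apply: divisorialClosureS.
- by move=> E _; apply: sub_divisorialClosure.
- by move=> E _; apply: divisorialClosure_idem.
Qed.

Lemma mulSub_scale z G : submodule G -> mulSub (scaleSub z O) G = scaleSub z G.
Proof.
move=> sG; apply/seteqP; split.
  apply: dspan_min; first exact: scaleSub_submodule.
  move=> _ [_ [a Oa <-] [g Gg <-]]; exists (a * g); last by rewrite mulrA.
  exact: submoduleM.
move=> _ [g Gg <-]; apply: sub_dspan; exists z; last by exists g.
by exists 1; [apply: subringSet1 OR | rewrite mulr1].
Qed.

Lemma mulSub_domain E : submodule E -> mulSub E O = E.
Proof.
move=> sE; apply/seteqP; split.
  apply: dspan_min => // _ [x Ex [d Od <-]]; rewrite mulrC; exact: submoduleM.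
move=> x Ex; apply: sub_dspan; exists x => //.
by exists 1; [apply: subringSet1 OR | rewrite mulr1].
Qed.

(** * Star operations on a valuation domain *)

Section Valuation.
Hypothesis valO : forall x, x != 0 -> O x \/ O x^-1.

(** By induction: of the new element and the generator found so far, one divides the other. The
    empty list is generated by 0. *)
Lemma dspan_seq_principal (s : seq K) :
  exists2 z, dspan [set` s] z & dspan [set` s] `<=` scaleSub z O.
Proof.
have sz z := scaleSub_submodule z domainSub_submodule.
have memz z : scaleSub z O z.
  by exists 1; [apply: subringSet1 OR | rewrite mulr1].
elim: s => [|x s [z sz_z zs]].
  exists 0; first exact: submodule0 (dspan_submodule _).
  by apply: dspan_min.
have ss : dspan [set` s] `<=` dspan [set` x :: s].
  apply: dspan_min; first exact: dspan_submodule.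
  by move=> y ys; apply: sub_dspan; rewrite /= inE [y \in s]ys orbT.
have sx : dspan [set` x :: s] x by apply: sub_dspan; rewrite /= inE eqxx.
suff [xz|zx] : scaleSub z O x \/ scaleSub x O z.
- exists z; first exact: ss.
  apply: dspan_min => // y /=; rewrite inE => /predU1P[->//|ys].
  by apply: zs; apply: sub_dspan.
- exists x => //; apply: dspan_min => // y /=; rewrite inE => /predU1P[->//|ys].
  have [d Od <-] : scaleSub z O y by apply: zs; apply: sub_dspan.
  by rewrite mulrC; apply: submoduleM.
have [->|x0] := eqVneq x 0; first by left; apply: submodule0.
have [->|z0] := eqVneq z 0; first by right; apply: submodule0.
have xz0 : z^-1 * x != 0 by rewrite mulf_neq0 ?invr_eq0.
have [Ozx|Oxz] := valO xz0; [left|right]; apply/mem_scaleSub => //.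
by rewrite invfM invrK mulrC in Oxz.
Qed.

Lemma fgFracIdeal_principal F :
  fgFracIdeal F -> exists2 z, z != 0 & F = scaleSub z O.
Proof.
move=> [fF [_ /finite_seqP[s ->] FE]].
have [z Fz zF] := dspan_seq_principal s; rewrite -FE in Fz zF.
have FzE : F = scaleSub z O.
  apply/seteqP; split=> // _ [d Od <-]; rewrite mulrC.
  by apply: submoduleM => //; apply: fracIdeal_submodule.
exists z => //; apply/eqP => z0.
have [x + /eqP x0] := fracIdeal_nonzero fF.
by rewrite FzE z0 => -[y _]; rewrite mul0r => /esym.
Qed.

(** With [F = zD] the product [FG] is [zG], so [star] commutes with the factor [z], which
    cancels. *)
Lemma star_ab (star : set K -> set K) : starOperation star -> abStar star.
Proof.
move=> hs F G H /fgFracIdeal_principal[z z0 ->] fG fH.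
have sG := fracIdeal_submodule fG; have sH := fracIdeal_submodule fH.
rewrite !mulSub_scale // !(star_scale hs) // => GH.
rewrite -[star G]scaleSub1 -[star H]scaleSub1 -(mulVf z0) !scaleSubM.
exact: scaleSubS.
Qed.

(** The nonunits of [O]: for [x != 0], [valO] makes [x] an element of [O] once [x^-1] is not. Zero
    is listed apart since [0^-1 = 0] lies in [O]. *)
Definition maxIdeal : set K := [set x | x = 0 \/ ~ O x^-1].

Lemma maxIdeal_sub : maxIdeal `<=` O.
Proof.
move=> x [->|Ox]; first exact: subringSet0 OR.
have [->|x0] := eqVneq x 0; first exact: subringSet0 OR.
by case: (valO x0).
Qed.

Lemma maxIdeal_mul x y : O x -> maxIdeal y -> maxIdeal (x * y).
Proof.
move=> Ox [->|Oy]; first by left; rewrite mulr0.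
have [->|x0] := eqVneq x 0; first by left; rewrite mul0r.
right; rewrite invfM => Oxy; apply: Oy.
by rewrite -(mulVKf x0 y^-1); apply: (subringSetM OR).
Qed.

Lemma maxIdeal_submodule : submodule maxIdeal.
Proof.
split; first by left.
(* The summand dividing the other is factored out: [x + y = (1 + x^-1 * y) * x]. *)
- have key x y : x != 0 -> O (x^-1 * y) -> maxIdeal x -> maxIdeal (x + y).
    move=> x0 Oxy Mx; rewrite -[y](mulVKf x0) -{1}[x]mulr1 -mulrDr mulrC.
    by apply: maxIdeal_mul => //; apply: (subringSetD OR) => //; apply: subringSet1 OR.
  move=> x y Mx My.
  have [->|x0] := eqVneq x 0; first by rewrite add0r.
  have [->|y0] := eqVneq y 0; first by rewrite addr0.
  have xy0 : x^-1 * y != 0 by rewrite mulf_neq0 ?invr_eq0.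
  have [Oxy|Oyx] := valO xy0; first exact: key.
  by rewrite addrC; apply: key => //; rewrite invfM invrK mulrC in Oyx.
- by move=> d x; apply: maxIdeal_mul; exists d.
Qed.

(* tau is the inverse of a t with radical M: it lies in every proper overring. *)
Variable tau : K.
Hypothesis tauO : ~ O tau.
(** Read on inverses, this and the next hypothesis say that every nonzero element of [maxIdeal] has
    a power divisible by [tau^-1] and is the square of an element of [maxIdeal]. *)
Hypothesis tau_pow : forall x, ~ O x -> exists2 c, O c & exists n, tau = c * x ^+ n.
Hypothesis sqrO : forall x, ~ O x -> exists2 y, ~ O y & x = y ^+ 2.

Lemma maxIdeal_fracIdeal : fracIdeal maxIdeal.
Proof.
split; first exact: maxIdeal_submodule.
  have tau0 : tau != 0.
    by apply/eqP => tau_eq0; apply: tauO; rewrite tau_eq0; apply: subringSet0 OR.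
  by exists tau^-1; [right; rewrite invrK | rewrite invr_eq0].
exists 1; first exact: oner_neq0.
by rewrite tofrac1 scaleSub1; apply: maxIdeal_sub.
Qed.

(** Suppose [zO] contains [maxIdeal] but not 1. Then [z^-1 = y ^+ 2] with [y] outside [O], so [y^-1]
    is in [maxIdeal], hence in [zO], and [z^-1 * y^-1 = y] is in [O], a contradiction. *)
Lemma divisorialClosure_maxIdeal1 : maxIdeal^v 1.
Proof.
have tau0 : tau != 0.
  by apply/eqP => tau_eq0; apply: tauO; rewrite tau_eq0; apply: subringSet0 OR.
move=> z Mz.
have z0 : z != 0.
  apply/eqP => z0; have [|y _] := Mz tau^-1; first by right; rewrite invrK.
  by rewrite z0 mul0r => /esym /eqP; rewrite invr_eq0 (negPf tau0).
apply/mem_scaleSub => //; rewrite mulr1.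
apply: contrapT => /[dup] Oz /sqrO[y Oy zE].
have y0 : y != 0 by apply/eqP => y0; apply: Oy; rewrite y0; apply: subringSet0 OR.
have /Mz /mem_scaleSub : maxIdeal y^-1 by right; rewrite invrK.
by move=> /(_ z0); rewrite zE expr2 mulfK.
Qed.

Lemma properOverring_tau V : valuationOverring V -> V != O -> V tau.
Proof.
move=> hV nVO.
have [x Vx Ox] : exists2 x, V x & ~ O x.
  apply: contrapT => nV; case/eqP: nVO; apply/seteqP; split; last exact: overring_domain.
  by move=> x Vx; apply: contrapT => Ox; apply: nV; exists x.
have [c Oc [n ->]] := tau_pow Ox.
have V1 : V 1 by apply: (overring_domain hV); apply: subringSet1 OR.
apply: overringM => //; first exact: overring_domain.
elim: n => [//|n IHn]; rewrite exprS; exact: overringM.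
Qed.

Lemma divisorialClosure_not_W : ~ WOperation divisorialClosure.
Proof.
move=> [_ [W [valW OW starW]]].
(* Otherwise every member of [W] contains [tau], and so does their intersection [O]. *)
have WO : W O.
  apply: contrapT => WO; apply: tauO; rewrite OW => V WV.
  apply: properOverring_tau; first exact: valW.
  by apply/eqP => VO; apply: WO; rewrite -VO.
have := divisorialClosure_maxIdeal1.
rewrite (starW _ maxIdeal_fracIdeal) => /(_ _ WO).
rewrite mulSub_domain; last exact: maxIdeal_submodule.
move=> [/eqP|]; first by rewrite oner_eq0.
by rewrite invr1; apply; apply: subringSet1 OR.
Qed.

End Valuation.
End FractionField.

(** * Transfer from the maximal subring to its quotient field *)

Section MaximalAvoidingFractions.
Variables (L : fieldType) (u : L) (S : set L).
Hypotheses (maxS : maximalAvoiding u S) (Suinv : S u^-1).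
Hypothesis sqrL : forall x : L, exists y, x = y ^+ 2.

Let subS : subringSet S. Proof. by case: maxS. Qed.
Local Notation D := (subringDomain subS).
Local Notation K := {fraction D}.
Local Notation "x %:F" := (@tofrac D x).
Local Notation O := (@domainSub D).

(** Writing [x] as a quotient, the valuation property inside [L] tells which of numerator and
    denominator divides the other in [D]. *)
Lemma maximalAvoiding_fracP (x : K) :
  O x \/ exists2 y : D, ~ S (val y)^-1 & x = y%:F^-1.
Proof.
have [a [b [b0 xE]]] := fracP x.
have vb0 : val b != 0 by rewrite subringDomain_val_eq0.
have [a0|a0] := eqVneq a 0.
  by left; exists 0 => //; rewrite xE a0 !tofrac0 mul0r.
have va0 : val a != 0 by rewrite subringDomain_val_eq0.
have ab0 : val a / val b != 0 by rewrite mulf_neq0 ?invr_eq0.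
have [Sab|nSab] := pselect (S (val a / val b)).
  have [z az] := subringDomain_dvd b0 Sab; left; exists z => //.
  by rewrite xE az tofracM mulfK // tofrac_eq0.
have [//|] := maximalAvoiding_valuation maxS Suinv ab0.
rewrite invfM invrK mulrC => /(subringDomain_dvd a0)[z bz]; right; exists z.
  by move: nSab; rewrite bz rmorphM /= invfM mulrCA mulfV // mulr1.
by rewrite xE bz tofracM invfM mulrCA mulfV ?mulr1 // tofrac_eq0.
Qed.

Lemma maximalAvoiding_frac_valuation (x : K) : x != 0 -> O x \/ O x^-1.
Proof.
move=> _; have [Ox|[y _ ->]] := maximalAvoiding_fracP x; first by left.
by right; exists y => //; rewrite invrK.
Qed.

Let nSV_neq0 (y : D) : ~ S (val y)^-1 -> y != 0.
Proof.
by move=> nSy; apply/eqP => y0; apply: nSy; rewrite y0 rmorph0 invr0; apply: subringSet0.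
Qed.

Section UniformBound.
Variable t : D.
Hypothesis tE : val t = u^-1.

Let t_neq0 : t != 0.
Proof. by apply: nSV_neq0; rewrite tE invrK; case: maxS. Qed.

Lemma maximalAvoiding_frac_tauO : ~ O t%:F^-1.
Proof. by move=> /(domainSub_tofracV t_neq0); rewrite tE invrK; case: maxS. Qed.

(** Here [x] is the inverse of a nonunit [y], and [c = u * y ^+ n] lies in [S] for some [n] by the
    radical property. *)
Lemma maximalAvoiding_frac_tau_pow (x : K) :
  ~ O x -> exists2 c, O c & exists n, t%:F^-1 = c * x ^+ n.
Proof.
move=> Ox; have [//|[y nSy ->]] := maximalAvoiding_fracP x.
have y0 := nSV_neq0 nSy.
have vy0 : val y != 0 by rewrite subringDomain_val_eq0.
have [n Sn] := maximalAvoiding_rad maxS vy0 (subringDomain_mem y) nSy.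
exists (mkSubringDomain subS Sn)%:F.
  by exists (mkSubringDomain subS Sn).
exists n.
have yF0 : y%:F ^+ n != 0 by rewrite expf_neq0 ?tofrac_eq0.
have tF0 : t%:F != 0 by rewrite tofrac_eq0 t_neq0.
apply: (mulfI tF0); apply: (mulIf yF0).
rewrite exprVn (mulfV tF0) mul1r mulrA (mulfVK yF0).
rewrite -tofracM -tofracXn; congr (_%:F); apply: val_inj.
have u0 : u != 0 by rewrite -invr_eq0 -tE subringDomain_val_eq0 t_neq0.
by rewrite rmorphXn rmorphM /= [subringDomain_val t]tE mulKf.
Qed.
End UniformBound.

(** A square root [w] of the nonunit [y] exists in [L]. Its inverse is not in [S], as the square of
    that inverse would be [y^-1]; so [w] is in [S] by the valuation property. *)
Lemma maximalAvoiding_frac_sqr (x : K) : ~ O x -> exists2 y, ~ O y & x = y ^+ 2.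
Proof.
move=> Ox; have [//|[y nSy xE]] := maximalAvoiding_fracP x.
have y0 := nSV_neq0 nSy.
have [w wE] := sqrL (val y).
have w0 : w != 0 by rewrite -sqrf_eq0 -wE subringDomain_val_eq0.
have nSw : ~ S w^-1.
  by move=> Sw; apply: nSy; rewrite wE -exprVn; apply: subringSetX.
have [Sw|//] := maximalAvoiding_valuation maxS Suinv w0.
exists (mkSubringDomain subS Sw)%:F^-1.
  have m0 : mkSubringDomain subS Sw != 0 by apply: nSV_neq0.
  by move=> /(domainSub_tofracV m0).
rewrite xE exprVn -tofracXn; congr (_%:F^-1); apply: val_inj.
by rewrite rmorphXn.
Qed.

Lemma maximalAvoiding_ab_not_W :
  exists (D : idomainType) (star : set {fraction D} -> set {fraction D}),
    [/\ starOperation star, abStar star & ~ WOperation star].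
Proof.
exists D, (@divisorialClosure D); split.
- exact: divisorialClosure_star.
- by apply: star_ab; [apply: maximalAvoiding_frac_valuation | apply: divisorialClosure_star].
- have tE : val (mkSubringDomain subS Suinv) = u^-1 by [].
  exact: (divisorialClosure_not_W maximalAvoiding_frac_valuation
    (maximalAvoiding_frac_tauO tE) (maximalAvoiding_frac_tau_pow tE)
    maximalAvoiding_frac_sqr).
Qed.
End MaximalAvoidingFractions.

(** * The example inside the algebraic numbers *)

Lemma Num_int_subringSet : subringSet [set x : algC | x \in Num.int].
Proof. by split=> [|x y|x y] /=; [apply: rpred1 | apply: rpredB | apply: rpredM]. Qed.

Lemma half_notin_Num_int : (2^-1 : algC) \notin Num.int.
Proof.
apply/negP => /intrP[m mE].
have : (m * 2)%:~R = 1%:~R :> algC.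
  by rewrite intrM -mE mulVf // pnatr_eq0.
by move=> /intr_inj; case: m {mE} => // -[//|[|n]].
Qed.

Theorem mainTheorem5 :
  exists (D : idomainType) (star : set {fraction D} -> set {fraction D}),
    [/\ starOperation star, abStar star & ~ WOperation star].
Proof.
have [S maxS _] := exists_maximalAvoiding Num_int_subringSet (negP half_notin_Num_int).
have S2 : S (2^-1)^-1.
  have [subS _ _] := maxS; rewrite invrK -[2]/(1 + 1).
  by apply: subringSetD => //; apply: subringSet1.
apply: (maximalAvoiding_ab_not_W maxS S2) => x.
by exists (sqrtC x); rewrite sqrtCK.
Qed.
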